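(* No intermediate logic that enjoys the disjunction property defines any of the following connectives: (1) Kreisel's star connective $\ast(X):=\exists Y.\,\bigl(X\leftrightarrow(\neg Y\vee\neg\neg Y)\bigr)$; (2) the regular connective $\exists Y.\,\bigl(X\leftrightarrow(\neg\neg Y\vee(\neg\neg Y\rightarrow Y))\bigr)$; (3) the regular connective $\exists Y.\,\bigl(X\leftrightarrow((\neg\neg Y\rightarrow Y)\rightarrow(Y\vee\neg Y))\bigr)$.
   Context: Formulas of second-order intuitionistic propositional logic are built from propositional variables and $\bot$ using $\wedge,\vee,\rightarrow$ and the propositional quantifiers $\forall X,\exists X$; $\neg A$ abbreviates $A\rightarrow\bot$ and $A\leftrightarrow B$ abbreviates $(A\rightarrow B)\wedge(B\rightarrow A)$. $\Gamma\vdash A$ denotes derivability in the standard Gentzen-style intuitionistic sequent calculus for this language (quantifiers may be instantiated by arbitrary formulas). An intermediate logic $\mathcal{L}$ is a logic obtained from a finitely axiomatizable intermediate propositional logic $L$ (between intuitionistic and classical propositional logic) by setting $\Gamma\vdash_{\mathcal{L}}A$ iff $\Gamma,\Lambda\vdash A$, where $\Lambda$ consists of the second-order universal closures of the axioms of $L$. $\mathcal{L}$ defines a connective $C(X)$ if there is a quantifier-free formula $\Psi(X)$ in the variable $X$ with $C(X)\vdash_{\mathcal{L}}\Psi(X)$ and $\Psi(X)\vdash_{\mathcal{L}}C(X)$. $\mathcal{L}$ enjoys the disjunction property if for all quantifier-free formulas $A,B$, $\vdash_{\mathcal{L}}A\vee B$ implies $\vdash_{\mathcal{L}}A$ or $\vdash_{\mathcal{L}}B$.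 *)

(* Defs.v *)
From Stdlib Require Import List Permutation.
Import ListNotations.

(** Second-order propositional formulas, with de Bruijn indices: [All] and [Ex]
    bind index 0 of their body. *)
Inductive form : Type :=
| Var (n : nat)
| Bot
| And (A B : form)
| Or (A B : form)
| Imp (A B : form)
| All (A : form)
| Ex (A : form).

Definition Neg (A : form) : form := Imp A Bot.
Definition Iff (A B : form) : form := And (Imp A B) (Imp B A).

Definition scons {T : Type} (x : T) (s : nat -> T) (n : nat) : T :=
  match n with 0 => x | S m => s m end.

Fixpoint rename (r : nat -> nat) (A : form) : form :=
  match A with
  | Var n => Var (r n)
  | Bot => Bot
  | And B C => And (rename r B) (rename r C)
  | Or B C => Or (rename r B) (rename r C)
  | Imp B C => Imp (rename r B) (rename r C)
  | All B => All (rename (scons 0 (fun n => S (r n))) B)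
  | Ex B => Ex (rename (scons 0 (fun n => S (r n))) B)
  end.

Definition lift : form -> form := rename S.

(** Simultaneous capture-avoiding substitution. *)
Fixpoint subst (s : nat -> form) (A : form) : form :=
  match A with
  | Var n => s n
  | Bot => Bot
  | And B C => And (subst s B) (subst s C)
  | Or B C => Or (subst s B) (subst s C)
  | Imp B C => Imp (subst s B) (subst s C)
  | All B => All (subst (scons (Var 0) (fun n => lift (s n))) B)
  | Ex B => Ex (subst (scons (Var 0) (fun n => lift (s n))) B)
  end.

(** [inst A B] is [A] with its index 0 instantiated by [B]. *)
Definition inst (A B : form) : form := subst (scons B Var) A.

Fixpoint qf (A : form) : Prop :=
  match A with
  | Var _ | Bot => True
  | And B C | Or B C | Imp B C => qf B /\ qf C
  | All _ | Ex _ => False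
  end.

(** The least [k] such that every free index of the formula is below [k]. *)
Fixpoint free_bound (A : form) : nat :=
  match A with
  | Var n => S n
  | Bot => 0
  | And B C | Or B C | Imp B C => Nat.max (free_bound B) (free_bound C)
  | All B | Ex B => Nat.pred (free_bound B)
  end.

Definition closure (A : form) : form := Nat.iter (free_bound A) All A.

(** Gentzen's LJ with impredicative propositional quantifiers. The eigenvariable
    conditions of [allR] and [exL] are enforced by lifting the side formulas. *)
Inductive derives : list form -> form -> Prop :=
| ax A : derives [A] A
| botL C : derives [Bot] C
| cut G D A C : derives G A -> derives (A :: D) C -> derives (G ++ D) C
| weakening G A C : derives G C -> derives (A :: G) C
| contraction G A C : derives (A :: A :: G) C -> derives (A :: G) C
| exchange G D C : Permutation G D -> derives G C -> derives D C
| andR G A B : derives G A -> derives G B -> derives G (And A B)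
| andL1 G A B C : derives (A :: G) C -> derives (And A B :: G) C
| andL2 G A B C : derives (B :: G) C -> derives (And A B :: G) C
| orR1 G A B : derives G A -> derives G (Or A B)
| orR2 G A B : derives G B -> derives G (Or A B)
| orL G A B C :
    derives (A :: G) C -> derives (B :: G) C -> derives (Or A B :: G) C
| impR G A B : derives (A :: G) B -> derives G (Imp A B)
| impL G D A B C :
    derives G A -> derives (B :: D) C -> derives (Imp A B :: G ++ D) C
| allR G A : derives (map lift G) A -> derives G (All A)
| allL G A B C : derives (inst A B :: G) C -> derives (All A :: G) C
| exR G A B : derives G (inst A B) -> derives G (Ex A)
| exL G A C : derives (A :: map lift G) (lift C) -> derives (Ex A :: G) C.

Inductive ipc_axiom : form -> Prop :=
| ipc_K A B : ipc_axiom (Imp A (Imp B A))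
| ipc_S A B C :
    ipc_axiom (Imp (Imp A (Imp B C)) (Imp (Imp A B) (Imp A C)))
| ipc_and1 A B : ipc_axiom (Imp (And A B) A)
| ipc_and2 A B : ipc_axiom (Imp (And A B) B)
| ipc_and3 A B : ipc_axiom (Imp A (Imp B (And A B)))
| ipc_or1 A B : ipc_axiom (Imp A (Or A B))
| ipc_or2 A B : ipc_axiom (Imp B (Or A B))
| ipc_or3 A B C :
    ipc_axiom (Imp (Imp A C) (Imp (Imp B C) (Imp (Or A B) C)))
| ipc_bot A : ipc_axiom (Imp Bot A).

(** [prop_logic axs] is the (quantifier-free) propositional logic
    [Int + axs]: the axioms [axs] may be used under arbitrary substitutions. *)
Inductive prop_logic (axs : list form) : form -> Prop :=
| pl_ipc A : ipc_axiom A -> qf A -> prop_logic axs A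
| pl_axiom s A : In A axs -> qf (subst s A) -> prop_logic axs (subst s A)
| pl_mp A B : prop_logic axs (Imp A B) -> prop_logic axs A -> prop_logic axs B.

Definition Int : form -> Prop := prop_logic [].
Definition Cl : form -> Prop := prop_logic [Or (Var 0) (Neg (Var 0))].

Record intermediate_prop (L : form -> Prop) : Prop := {
  ip_Int : forall A, Int A -> L A;
  ip_Cl : forall A, L A -> Cl A;
  ip_mp : forall A B, L (Imp A B) -> L A -> L B;
  ip_subst : forall s A, (forall n, qf (s n)) -> L A -> L (subst s A)
}.

Definition axiomatizes (axs : list form) (L : form -> Prop) : Prop :=
  (forall A, In A axs -> qf A) /\ (forall A, L A <-> prop_logic axs A).

Record intermediate_logic : Type := {
  base : form -> Prop;
  base_intermediate : intermediate_prop base;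
  axioms : list form;
  axioms_base : axiomatizes axioms base
}.

Definition derives_in (L : intermediate_logic) (G : list form) (A : form) : Prop :=
  derives (G ++ map closure (axioms L)) A.

(** A unary connective [C(X)] is given as a formula in which [Var 0] stands for
    [X]. *)
Definition defines (L : intermediate_logic) (C : form) : Prop :=
  exists Psi : form,
    qf Psi /\ free_bound Psi <= 1 /\
    derives_in L [C] Psi /\ derives_in L [Psi] C.

Definition disjunction_property (L : intermediate_logic) : Prop :=
  forall A B : form, qf A -> qf B ->
    derives_in L [] (Or A B) -> derives_in L [] A \/ derives_in L [] B.

(** Connectives of the form [exists Y, X <-> phi(Y)], where [Var 0] stands for
    [Y] in [phi]; under the quantifier, [X] is [Var 1]. *)
Definition ex_iff (phi : form) : form := Ex (Iff (Var 1) phi).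

Definition kreisel_star : form :=
  ex_iff (Or (Neg (Var 0)) (Neg (Neg (Var 0)))).

Definition regular_or : form :=
  ex_iff (Or (Neg (Neg (Var 0))) (Imp (Neg (Neg (Var 0))) (Var 0))).

Definition regular_imp : form :=
  ex_iff (Imp (Imp (Neg (Neg (Var 0))) (Var 0)) (Or (Var 0) (Neg (Var 0)))).

(* Main.v *)
From Stdlib Require Import List Permutation Lia Classical ClassicalEpsilon.
Import ListNotations.
Require Import Defs.

(** The proof rests on the two-element chain, the smallest Kripke frame that is
    not classical; its upsets form the three-element Heyting algebra with
    values 0, 1/2 and 1.

    If a formula [D] is dense, that is, if [~~D] is provable, then [Bot], [D] and
    a provable formula are closed under the connectives up to provable
    equivalence, exactly like 0, 1/2 and 1. So a quantifier-free formula whose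
    variables are replaced by these three formulas is equivalent to the one
    that codes its value on the chain ([codes_subst]). This is used twice.

    Suppose that an axiom of a logic [L] fails on the chain, and take for [D]
    the formula [X \/ ~X]. A suitable instance of the axiom then implies
    [X \/ ~X], and the disjunction property would make [X] or [~X] provable in
    [L], which is impossible because [L] is contained in classical logic. So a
    logic with the disjunction property is sound for the chain
    ([chain_sound]), where propositional quantifiers range over all upsets.

    Let now [phi(Y)] be dense and valid on the chain, and suppose that a
    quantifier-free [Psi(X)] defines [exists Y, X <-> phi(Y)] in [L]. On the
    chain, the connective takes the value of [X] itself, since [phi(Y)] is
    always 1; so [Psi] has the value 1/2 at 1/2, and hence [Psi(D)] implies [D]
    for every dense [D]. With [D := phi(Y)], the connective holds of [D]
    trivially, so [L] proves [Psi(phi(Y))] and therefore [phi(Y)] itself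
    ([ex_iff_undefinable]). For the three formulas [phi] in question this
    contradicts the disjunction property. *)

(** * Substitution *)

Lemma subst_ext_bounded A : forall s s',
  (forall n, n < free_bound A -> s n = s' n) -> subst s A = subst s' A.
Proof.
  induction A; simpl; intros s s' H; f_equal; auto;
    try (apply IHA1 || apply IHA2; intros; apply H; lia);
    apply IHA; intros [|n] Hn; simpl; auto; rewrite H; auto; lia.
Qed.

Lemma subst_ext A s s' : (forall n, s n = s' n) -> subst s A = subst s' A.
Proof. intros H; apply subst_ext_bounded; auto. Qed.

Lemma rename_as_subst A : forall r, rename r A = subst (fun n => Var (r n)) A.
Proof.
  induction A; simpl; intros r; f_equal; auto;
    rewrite IHA; apply subst_ext; intros [|n]; reflexivity.
Qed.

Lemma subst_Var A : subst Var A = A.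
Proof.
  induction A; simpl; f_equal; auto;
    transitivity (subst Var A); auto; apply subst_ext; intros [|n]; reflexivity.
Qed.

Lemma subst_id_bounded A s :
  (forall n, n < free_bound A -> s n = Var n) -> subst s A = A.
Proof. intros H; rewrite <- (subst_Var A) at 2; apply subst_ext_bounded; auto. Qed.

Lemma subst_rename A : forall r s,
  subst s (rename r A) = subst (fun n => s (r n)) A.
Proof.
  induction A; simpl; intros r s; f_equal; auto;
    rewrite IHA; apply subst_ext; intros [|n]; reflexivity.
Qed.

Lemma rename_rename A r r' : rename r' (rename r A) = rename (fun n => r' (r n)) A.
Proof.
  rewrite (rename_as_subst (rename r A)), subst_rename, rename_as_subst.
  reflexivity.
Qed.

Lemma rename_subst A : forall r s,
  rename r (subst s A) = subst (fun n => rename r (s n)) A.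
Proof.
  induction A; simpl; intros r s; f_equal; auto;
    rewrite IHA; apply subst_ext; intros [|n]; simpl; auto;
    unfold lift; rewrite !rename_rename; reflexivity.
Qed.

Lemma subst_subst A : forall s t,
  subst t (subst s A) = subst (fun n => subst t (s n)) A.
Proof.
  induction A; simpl; intros s t; f_equal; auto;
    rewrite IHA; apply subst_ext; intros [|n]; simpl; auto;
    unfold lift; rewrite subst_rename, rename_subst; reflexivity.
Qed.

Lemma inst_lift A B : inst (lift A) B = A.
Proof. unfold inst, lift; rewrite subst_rename; apply subst_Var. Qed.

Lemma free_bound_closure A : free_bound (closure A) = 0.
Proof.
  unfold closure.
  enough (E : forall n, free_bound (Nat.iter n All A) = free_bound A - n)
    by (rewrite E; lia).
  induction n; simpl; [|rewrite IHn]; lia.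
Qed.

Lemma lift_closed A : free_bound A = 0 -> lift A = A.
Proof.
  intros H; unfold lift; rewrite rename_as_subst.
  apply subst_id_bounded; rewrite H; lia.
Qed.

(** * Derived rules of the sequent calculus *)

Lemma derives_app G D C : derives D C -> derives (G ++ D) C.
Proof. induction G; simpl; auto using weakening. Qed.

Lemma derives_absorb G D C : incl G D -> derives (G ++ D) C -> derives D C.
Proof.
  induction G as [|A G IH]; simpl; auto.
  intros HI H; apply IH; [intros x Hx; apply HI; right; auto|].
  assert (HA : In A (G ++ D)) by (apply in_or_app; right; apply HI; left; auto).
  destruct (in_split _ _ HA) as (D1 & D2 & E); rewrite E in *.
  apply (exchange (A :: D1 ++ D2)); [apply Permutation_middle|].
  apply contraction.
  apply (exchange (A :: D1 ++ A :: D2)); auto.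
  apply perm_skip, Permutation_sym, Permutation_middle.
Qed.

Lemma derives_incl G D C : incl G D -> derives G C -> derives D C.
Proof.
  intros HI H; apply (derives_absorb G); auto.
  apply (exchange (D ++ G)); [apply Permutation_app_comm|].
  apply derives_app; auto.
Qed.

Ltac in_context :=
  let x := fresh in intros x; simpl; rewrite ?in_app_iff; simpl; tauto.

Lemma assumption G A : In A G -> derives G A.
Proof.
  intros H; apply (derives_incl [A]); [|apply ax].
  intros x [<-|[]]; auto.
Qed.

Lemma cut_same G A C : derives G A -> derives (A :: G) C -> derives G C.
Proof.
  intros H1 H2; apply (derives_incl (G ++ G)); [in_context|].
  apply (cut _ _ A); auto.
Qed.

Lemma cut_single G A C : derives G A -> derives [A] C -> derives G C.
Proof.
  intros H1 H2; apply (cut_same G A); auto.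
  apply (derives_incl [A]); auto; in_context.
Qed.

Lemma of_theorem G C : derives [] C -> derives G C.
Proof. apply derives_incl; in_context. Qed.

Lemma impE G A B : derives G (Imp A B) -> derives G A -> derives G B.
Proof.
  intros H1 H2; apply (cut_same G (Imp A B)); auto.
  apply (derives_incl (Imp A B :: G ++ [])); [in_context|].
  apply impL; auto using ax.
Qed.

Lemma botE G C : derives G Bot -> derives G C.
Proof. intros H; apply (cut_single _ Bot); auto using botL. Qed.

Lemma derives_inst G A B :
  (forall C, In C G -> free_bound C = 0) -> derives G A -> derives G (inst A B).
Proof.
  intros HG H; apply (cut_single _ (All A)).
  - apply allR.
    replace (map lift G) with G; auto.
    symmetry; rewrite <- map_id; apply map_ext_in.
    intros C HC; apply lift_closed; auto.
  - apply (allL [] A B), ax.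
Qed.

Lemma closure_subst A s : derives [closure A] (subst s A).
Proof.
  assert (E : forall n s, derives [subst (fun k => s (n + k)) (Nat.iter n All A)]
                            (subst s A)).
  { induction n; intros t; simpl; [apply ax|].
    (* The outermost quantifier binds the variable [n] of [A]. *)
    apply allL with (B := t n).
    unfold inst; rewrite subst_subst.
    match goal with |- derives [subst ?u _] _ =>
      rewrite (subst_ext _ u (fun k => t (n + k))); auto end.
    intros [|k]; simpl; [f_equal; lia|].
    unfold lift; rewrite subst_rename; simpl.
    rewrite subst_Var; f_equal; lia. }
  specialize (E (free_bound A) s).
  change (Nat.iter (free_bound A) All A) with (closure A) in E.
  rewrite subst_id_bounded in E; auto.
  rewrite free_bound_closure; lia.
Qed.

(** * Kripke semantics *)

Record frame : Type := {
  world :> Type;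
  acc : world -> world -> Prop;
  acc_refl : forall w, acc w w;
  acc_trans : forall u v w, acc u v -> acc v w -> acc u w
}.

Arguments acc {f} _ _.

Definition upset {F : frame} (P : F -> Prop) : Prop :=
  forall u w, acc u w -> P u -> P w.

(** The principal semantics: the propositional quantifiers range over all
    upsets. They need no reference to later worlds, because every world has the
    same upsets as domain. *)
Fixpoint forces {F : frame} (v : nat -> F -> Prop) (w : F) (A : form) : Prop :=
  match A with
  | Var n => v n w
  | Bot => False
  | And B C => forces v w B /\ forces v w C
  | Or B C => forces v w B \/ forces v w C
  | Imp B C => forall u, acc w u -> forces v u B -> forces v u C
  | All B => forall P, upset P -> forces (scons P v) w B
  | Ex B => exists P, upset P /\ forces (scons P v) w B
  end.

Lemma upset_scons {F : frame} (P : F -> Prop) v :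
  upset P -> (forall n, upset (v n)) -> forall n, upset (scons P v n).
Proof. intros HP Hv [|n]; simpl; auto. Qed.

Lemma forces_persistent {F : frame} A : forall v : nat -> F -> Prop,
  (forall n, upset (v n)) -> upset (fun w => forces v w A).
Proof.
  induction A; simpl; intros v Hv u w Huw.
  - apply Hv; auto.
  - auto.
  - intros []; split; [eapply IHA1 | eapply IHA2]; eauto.
  - intros []; [left; eapply IHA1 | right; eapply IHA2]; eauto.
  - intros H x Hx; apply H; eapply acc_trans; eauto.
  - intros H P HP; eapply IHA; eauto using upset_scons.
  - intros (P & HP & H); exists P; split; auto.
    eapply IHA; eauto using upset_scons.
Qed.

Lemma forces_ext {F : frame} A : forall (v v' : nat -> F -> Prop) w,
  (forall n u, v n u <-> v' n u) -> (forces v w A <-> forces v' w A).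
Proof.
  induction A; simpl; intros v v' w H.
  - apply H.
  - tauto.
  - rewrite (IHA1 v v'), (IHA2 v v'); tauto.
  - rewrite (IHA1 v v'), (IHA2 v v'); tauto.
  - split; intros K u Hu; specialize (K u Hu);
      rewrite (IHA1 v v' u H), (IHA2 v v' u H) in *; auto.
  - assert (E : forall P n u, scons P v n u <-> scons P v' n u)
      by (intros P [|n] u; simpl; [tauto | apply H]).
    split; intros K P HP; specialize (K P HP); eapply (IHA _ _ w (E P)); auto.
  - assert (E : forall P n u, scons P v n u <-> scons P v' n u)
      by (intros P [|n] u; simpl; [tauto | apply H]).
    split; intros (P & HP & K); exists P; split; auto;
      eapply (IHA _ _ w (E P)); auto.
Qed.

Lemma forces_rename {F : frame} A : forall r (v : nat -> F -> Prop) w,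
  forces v w (rename r A) <-> forces (fun n => v (r n)) w A.
Proof.
  induction A; simpl; intros r v w.
  - tauto.
  - tauto.
  - rewrite IHA1, IHA2; tauto.
  - rewrite IHA1, IHA2; tauto.
  - split; intros K u Hu; specialize (K u Hu); rewrite IHA1, IHA2 in *; auto.
  - assert (E : forall P, forces (scons P v) w (rename (scons 0 (fun n => S (r n))) A)
                  <-> forces (scons P (fun n => v (r n))) w A)
      by (intros P; rewrite IHA; apply forces_ext; intros [|n]; simpl; tauto).
    split; intros K P HP; apply E; auto.
  - assert (E : forall P, forces (scons P v) w (rename (scons 0 (fun n => S (r n))) A)
                  <-> forces (scons P (fun n => v (r n))) w A)
      by (intros P; rewrite IHA; apply forces_ext; intros [|n]; simpl; tauto).
    split; intros (P & HP & K); exists P; split; auto; apply E; auto.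
Qed.

Lemma forces_lift {F : frame} A (v : nat -> F -> Prop) P w :
  forces (scons P v) w (lift A) <-> forces v w A.
Proof. unfold lift; rewrite forces_rename; apply forces_ext; simpl; tauto. Qed.

Lemma forces_subst {F : frame} A : forall s (v : nat -> F -> Prop) w,
  forces v w (subst s A) <-> forces (fun n u => forces v u (s n)) w A.
Proof.
  induction A; simpl; intros s v w.
  - tauto.
  - tauto.
  - rewrite IHA1, IHA2; tauto.
  - rewrite IHA1, IHA2; tauto.
  - split; intros K u Hu; specialize (K u Hu); rewrite IHA1, IHA2 in *; auto.
  - assert (E : forall P,
      forces (scons P v) w (subst (scons (Var 0) (fun n => lift (s n))) A)
      <-> forces (scons P (fun n u => forces v u (s n))) w A).
    { intros P; rewrite IHA; apply forces_ext; intros [|n] u; simpl;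
        [tauto | apply forces_lift]. }
    split; intros K P HP; apply E; auto.
  - assert (E : forall P,
      forces (scons P v) w (subst (scons (Var 0) (fun n => lift (s n))) A)
      <-> forces (scons P (fun n u => forces v u (s n))) w A).
    { intros P; rewrite IHA; apply forces_ext; intros [|n] u; simpl;
        [tauto | apply forces_lift]. }
    split; intros (P & HP & K); exists P; split; auto; apply E; auto.
Qed.

Lemma forces_inst {F : frame} A B (v : nat -> F -> Prop) w :
  forces v w (inst A B) <-> forces (scons (fun u => forces v u B) v) w A.
Proof.
  unfold inst; rewrite forces_subst; apply forces_ext.
  intros [|n] u; simpl; tauto.
Qed.

(** Impredicative instantiation is sound because the worlds forcing a formula
    form an upset, which is one of those that the quantifiers range over. *)
Lemma kripke_sound {F : frame} G C :
  derives G C ->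
  forall (v : nat -> F -> Prop) w, (forall n, upset (v n)) ->
  (forall A, In A G -> forces v w A) -> forces v w C.
Proof.
  induction 1; intros v w Hv HG; simpl in HG.
  - auto.
  - destruct (HG Bot); auto.
  - apply IHderives2; auto; intros B [<-|HB].
    + apply IHderives1; auto; intros; apply HG, in_or_app; auto.
    + apply HG, in_or_app; auto.
  - auto.
  - apply IHderives; auto; intros B [<-|[<-|HB]]; auto.
  - apply IHderives; auto; intros; apply HG; eapply Permutation_in; eauto.
  - split; auto.
  - apply IHderives; auto; intros D [<-|HD]; auto.
    apply (HG (And A B)); auto.
  - apply IHderives; auto; intros D [<-|HD]; auto.
    apply (HG (And A B)); auto.
  - left; auto.
  - right; auto.
  - destruct (HG (Or A B)); auto;
      [apply IHderives1 | apply IHderives2]; auto; intros D [<-|HD]; auto.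
  - intros u Hu HA; apply IHderives; auto; intros D [<-|HD]; auto.
    eapply forces_persistent; eauto.
  - apply IHderives2; auto; intros E [<-|HE].
    + apply (HG (Imp A B)); auto using acc_refl.
      apply IHderives1; auto; intros; apply HG; right; apply in_or_app; auto.
    + apply HG; right; apply in_or_app; auto.
  - intros P HP; apply IHderives; auto using upset_scons.
    intros B HB; apply in_map_iff in HB; destruct HB as (D & <- & HD).
    apply forces_lift; auto.
  - apply IHderives; auto; intros D [<-|HD]; auto.
    apply forces_inst; apply (HG (All A)); auto.
    apply forces_persistent; auto.
  - exists (fun u => forces v u B); split; [apply forces_persistent; auto|].
    apply forces_inst; auto.
  - destruct (HG (Ex A)) as (P & HP & HA); auto.
    apply (forces_lift C v P); apply IHderives; auto using upset_scons.
    intros B [<-|HB]; auto.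
    apply in_map_iff in HB; destruct HB as (D & <- & HD).
    apply forces_lift; auto.
Qed.

Lemma forces_closure {F : frame} A w :
  (forall v : nat -> F -> Prop, (forall n, upset (v n)) -> forces v w A) ->
  forall v : nat -> F -> Prop, (forall n, upset (v n)) -> forces v w (closure A).
Proof.
  intros H; unfold closure; induction (free_bound A); simpl; auto.
  intros v Hv P HP; auto using upset_scons.
Qed.

Lemma forces_ipc_axiom {F : frame} A (v : nat -> F -> Prop) w :
  (forall n, upset (v n)) -> ipc_axiom A -> forces v w A.
Proof.
  intros Hv HA.
  assert (Hp : forall B, upset (fun u => forces v u B))
    by (intros; apply forces_persistent; auto).
  unfold upset in Hp.
  destruct HA; simpl; intros; try tauto; eauto using acc_refl, acc_trans.
  match goal with H : _ \/ _ |- _ => destruct H end; eauto using acc_trans.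
Qed.

(** * The two-element chain *)

(** [false] is the root, [true] the maximal world. *)
Definition chain : frame.
Proof.
  refine {| world := bool; acc u w := u = true -> w = true |}; auto.
Defined.

Lemma chain_upset (P : chain -> Prop) : (P false -> P true) -> upset P.
Proof. intros H [|] [|] Ha; auto; discriminate (Ha eq_refl). Qed.

Lemma forces_false_Imp (v : nat -> chain -> Prop) A B :
  forces v (false : chain) (Imp A B) <->
  (forces v (false : chain) A -> forces v (false : chain) B) /\
  (forces v (true : chain) A -> forces v (true : chain) B).
Proof.
  simpl; split; [intros H; split; apply H; auto; discriminate|].
  intros [H1 H2] [|] _; auto.
Qed.

Lemma forces_true_Imp (v : nat -> chain -> Prop) A B :
  forces v (true : chain) (Imp A B) <->
  (forces v (true : chain) A -> forces v (true : chain) B).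
Proof.
  simpl; split; [auto|].
  intros H [|] Hu; [auto | discriminate (Hu eq_refl)].
Qed.

Lemma forces_Or {F : frame} (v : nat -> F -> Prop) w A B :
  forces v w (Or A B) <-> forces v w A \/ forces v w B.
Proof. reflexivity. Qed.

(** Both worlds see the maximal one, so it alone decides negations. *)
Lemma chain_forces_Neg (v : nat -> chain -> Prop) (w : chain) A :
  (forall n, upset (v n)) ->
  forces v w (Neg A) <-> ~ forces v (true : chain) A.
Proof.
  intros Hv; split.
  - intros H HA; apply (H (true : chain)); simpl; auto.
  - intros H u _ HA; apply H.
    apply (forces_persistent A v Hv u); simpl; auto.
Qed.

Definition dense (D : form) : Prop := derives [] (Neg (Neg D)).

Lemma dense_refutes_neg D G : dense D -> derives (D :: G) Bot -> derives G Bot.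
Proof.
  intros HD H; apply (impE _ (Neg D)); [apply of_theorem, HD | apply impR, H].
Qed.

Lemma dense_of_excluded_middle A D : derives [Or A (Neg A)] D -> dense D.
Proof.
  intros H; apply impR.
  assert (HN : derives [Neg D] (Neg A)).
  { apply impR, (impE _ D); [apply assumption; simpl; auto|].
    apply (cut_single _ (Or A (Neg A))); auto.
    apply orR1, assumption; simpl; auto. }
  apply (impE _ D); [apply ax|].
  apply (cut_single _ (Or A (Neg A))); auto.
  apply orR2, HN.
Qed.

(** [F] stands for the truth value [P]: it is provable, equivalent to [D], or
    refutable, according as [P] is everything, the maximal world, or empty.
    Splitting this into one condition per world and sign makes the clauses
    for the connectives independent of each other. *)
Record codes (D F : form) (P : chain -> Prop) : Prop := {
  codes_root : P false -> derives [] F;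
  codes_not_root : ~ P false -> derives [F] D;
  codes_top : P true -> derives [D] F;
  codes_not_top : ~ P true -> derives [F] Bot
}.

Lemma codes_exist D (P : chain -> Prop) : upset P -> exists F, codes D F P.
Proof.
  intros HP.
  assert (H : P false -> P true) by (apply HP; discriminate).
  destruct (classic (P false)); [|destruct (classic (P true))].
  - exists (Imp Bot Bot); constructor; intros; try tauto;
      apply impR, assumption; simpl; auto.
  - exists D; constructor; intros; try tauto; apply ax.
  - exists Bot; constructor; intros; try tauto; apply botL.
Qed.

Lemma codes_self D : codes D D (fun w => w = true).
Proof. constructor; intros; try discriminate; try tauto; apply ax. Qed.

Lemma codes_subst D s (v : nat -> chain -> Prop) A :
  dense D -> (forall n, codes D (s n) (v n)) -> qf A ->
  codes D (subst s A) (fun w => forces v w A).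
Proof.
  intros HD Hs; induction A; simpl subst; intros HA; try contradiction;
    try (destruct (IHA1 (proj1 HA)), (IHA2 (proj2 HA))).
  - apply Hs.
  - constructor; simpl; try tauto; intros; apply botL.
  - constructor; simpl; intros H.
    + apply andR; tauto.
    + apply not_and_or in H as [H|H]; [apply andL1|apply andL2]; auto.
    + apply andR; tauto.
    + apply not_and_or in H as [H|H]; [apply andL1|apply andL2]; auto.
  - constructor; simpl; intros H.
    + destruct H; [apply orR1|apply orR2]; auto.
    + apply orL; tauto.
    + destruct H; [apply orR1|apply orR2]; auto.
    + apply orL; tauto.
  - (* If the value of the implication is 0, then [D] proves the premise and the
       conclusion is refutable, so the implication contradicts density. *)
    assert (HT : forces v (true : chain) A1 -> ~ forces v (true : chain) A2 ->
                 derives [Imp (subst s A1) (subst s A2)] Bot).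
    { intros H1 H2; apply (dense_refutes_neg D); auto.
      apply (cut_single _ (subst s A2)); auto.
      apply (impE _ (subst s A1)); [apply assumption; simpl; auto|].
      apply (cut_single _ D); auto; apply assumption; simpl; auto. }
    constructor; rewrite ?forces_false_Imp, ?forces_true_Imp; intros H.
    + destruct H as [H1 H2]; apply impR.
      destruct (classic (forces v (false : chain) A2)); [apply of_theorem; auto|].
      destruct (classic (forces v (true : chain) A2)).
      * apply (cut_single _ D); auto.
      * apply botE; auto.
    + destruct (classic (forces v (true : chain) A1 /\
                         ~ forces v (true : chain) A2)) as [[H1 H2]|H'].
      * apply botE; auto.
      * apply (cut_single _ (subst s A2)); [|tauto].
        apply (impE _ (subst s A1)); [apply ax|].
        apply of_theorem; tauto.
    + apply impR.
      destruct (classic (forces v (true : chain) A2)).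
      * apply (cut_single _ D); auto; apply assumption; simpl; auto.
      * apply botE, (cut_single _ (subst s A1)); [|tauto].
        apply assumption; simpl; auto.
    + apply HT; tauto.
Qed.

(** * Soundness of logics with the disjunction property for the chain *)

Lemma closure_axioms_closed L C :
  In C (map closure (axioms L)) -> free_bound C = 0.
Proof.
  intros H; apply in_map_iff in H; destruct H as (A & <- & _).
  apply free_bound_closure.
Qed.

Lemma axioms_sound {F : frame} L (v : nat -> F -> Prop) w G C :
  (forall n, upset (v n)) ->
  (forall A u, In A (axioms L) -> (forall n, upset (u n)) -> forces u w A) ->
  derives_in L G C -> (forall A, In A G -> forces v w A) -> forces v w C.
Proof.
  intros Hv HA H HG; apply (kripke_sound _ _ H); auto.
  intros B HB; apply in_app_iff in HB; destruct HB as [HB|HB]; auto.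
  apply in_map_iff in HB; destruct HB as (A & <- & HB).
  apply forces_closure; auto.
Qed.

Lemma Cl_forces_top A (v : nat -> chain -> Prop) :
  (forall n, upset (v n)) -> Cl A -> forces v (true : chain) A.
Proof.
  intros Hv; induction 1.
  - apply forces_ipc_axiom; auto.
  - destruct H as [<-|[]]; simpl.
    destruct (classic (forces v (true : chain) (s 0))); auto.
    right; intros [|] Hu; [auto | discriminate (Hu eq_refl)].
  - rewrite forces_true_Imp in IHprop_logic1; auto.
Qed.

(** Every intermediate logic is sound at the maximal world, which sees
    classical logic only. *)
Lemma top_sound L A (v : nat -> chain -> Prop) :
  (forall n, upset (v n)) -> derives_in L [] A -> forces v (true : chain) A.
Proof.
  intros Hv H; apply (axioms_sound L v (true : chain) [] A); auto;
    [|intros ? []].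
  intros B u HB Hu; apply Cl_forces_top; auto.
  apply (ip_Cl _ (base_intermediate L)).
  destruct (axioms_base L) as [Hqf Hb]; apply Hb.
  rewrite <- (subst_Var B); apply pl_axiom; auto.
  rewrite subst_Var; auto.
Qed.

Lemma excluded_middle_underivable L :
  disjunction_property L -> ~ derives_in L [] (Or (Var 0) (Neg (Var 0))).
Proof.
  intros DP H; apply DP in H as [H|H]; simpl; auto.
  - apply (top_sound L _ (fun _ _ => False)) in H; auto; intros ? ? ?; auto.
  - apply (top_sound L _ (fun _ _ => True)) in H; [|intros ? ? ?; auto].
    apply (H (true : chain)); simpl; auto.
Qed.

Lemma axioms_valid_on_chain L A (v : nat -> chain -> Prop) :
  disjunction_property L -> In A (axioms L) -> (forall n, upset (v n)) ->
  forces v (false : chain) A.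
Proof.
  intros DP HA Hv; apply NNPP; intros HN.
  set (D := Or (Var 0) (Neg (Var 0))).
  assert (Hs : exists s, forall n, codes D (s n) (v n)).
  { assert (E : forall n, exists F, codes D F (v n))
      by (intros n; apply codes_exist; auto).
    exists (fun n => proj1_sig (constructive_indefinite_description _ (E n))).
    intros n; apply proj2_sig. }
  destruct Hs as [s Hs].
  apply (excluded_middle_underivable L DP).
  apply (cut_single _ (subst s A)).
  - apply (derives_incl [closure A]); [|apply closure_subst].
    intros B [<-|[]]; apply (in_map closure); auto.
  - apply (codes_not_root _ _ _ (codes_subst D s v A
      (dense_of_excluded_middle _ _ (ax _)) Hs
      (proj1 (axioms_base L) A HA)) HN).
Qed.

Lemma chain_sound L G C (v : nat -> chain -> Prop) :
  disjunction_property L -> (forall n, upset (v n)) -> derives_in L G C ->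
  (forall A, In A G -> forces v (false : chain) A) -> forces v (false : chain) C.
Proof.
  intros DP Hv; apply axioms_sound; auto.
  intros; apply (axioms_valid_on_chain L); auto.
Qed.

(** * Undefinability *)

Lemma derives_in_inst L A B : derives_in L [] A -> derives_in L [] (inst A B).
Proof. apply derives_inst, closure_axioms_closed. Qed.

(** A definition [Psi] would have to give [Psi(phi)] the truth value of [phi],
    although the connective is trivially true of [phi]. *)
Lemma ex_iff_undefinable L phi :
  disjunction_property L -> free_bound phi <= 1 -> dense phi ->
  (forall v : nat -> chain -> Prop,
     (forall n, upset (v n)) -> forces v (false : chain) phi) ->
  ~ derives_in L [] phi ->
  ~ defines L (ex_iff phi).
Proof.
  intros DP Hb Hd Hv Hn (Psi & Hqf & HPb & H1 & H2); apply Hn.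
  assert (HI : derives_in L [] (inst Psi phi)).
  { apply (impE _ (inst (ex_iff phi) phi)).
    - apply (derives_in_inst L (Imp (ex_iff phi) Psi)), impR, H1.
    - apply of_theorem, exR with (B := Var 0).
      assert (E : derives [] (Iff phi phi)) by (apply andR; apply impR, ax).
      unfold inst; simpl.
      fold (inst (lift phi) (Var 0)); rewrite inst_lift, subst_subst.
      rewrite subst_id_bounded; auto.
      (* [Y] is the only variable of [phi]. *)
      intros [|n] Hlt; simpl; auto; lia. }
  set (v := fun (n : nat) (w : chain) => w = true).
  assert (Hvu : forall n, upset (v n))
    by (intros n; apply chain_upset; unfold v; auto).
  assert (HN : ~ forces v (false : chain) Psi).
  { intros HP.
    destruct (chain_sound L [Psi] (ex_iff phi) v DP Hvu H2) as (P & HP' & _ & K).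
    - intros A [<-|[]]; auto.
    - (* The root would force [X], whose value is the maximal world alone. *)
      discriminate (K (false : chain) (fun e => e)).
      apply Hv, upset_scons; auto. }
  apply (cut_single _ (inst Psi phi)); auto.
  unfold inst; rewrite (subst_ext_bounded _ _ (fun _ => phi)).
  - apply (codes_not_root _ _ _
      (codes_subst phi _ v Psi Hd (fun n => codes_self phi) Hqf) HN).
  - intros [|n] Hlt; simpl; auto; lia.
Qed.

Lemma weak_excluded_middle_underivable L :
  disjunction_property L ->
  ~ derives_in L [] (Or (Neg (Var 0)) (Neg (Neg (Var 0)))).
Proof.
  intros DP H; apply DP in H as [H|H]; simpl; auto.
  - apply (top_sound L _ (fun _ _ => True)) in H; [|intros ? ? ?; auto].
    rewrite chain_forces_Neg in H by (intros ? ? ?; auto); simpl in H; tauto.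
  - apply (top_sound L _ (fun _ _ => False)) in H; [|intros ? ? ?; auto].
    rewrite !chain_forces_Neg in H by (intros ? ? ?; auto); simpl in H; tauto.
Qed.

Lemma regular_or_body_underivable L :
  disjunction_property L ->
  ~ derives_in L [] (Or (Neg (Neg (Var 0))) (Imp (Neg (Neg (Var 0))) (Var 0))).
Proof.
  intros DP H; apply DP in H as [H|H]; simpl; auto.
  - apply (top_sound L _ (fun _ _ => False)) in H; [|intros ? ? ?; auto].
    rewrite !chain_forces_Neg in H by (intros ? ? ?; auto); simpl in H; tauto.
  - (* Double negation elimination fails for the middle truth value. *)
    set (v := fun (n : nat) (w : chain) => w = true).
    assert (Hv : forall n, upset (v n))
      by (intros n; apply chain_upset; unfold v; auto).
    apply (chain_sound L _ _ v DP Hv) in H; [|intros ? []].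
    rewrite forces_false_Imp, !chain_forces_Neg in H by auto.
    simpl in H; destruct H as [H _]; discriminate H; unfold v; auto.
Qed.

(** At [Y := ~Y] the premise [~~Y -> Y] becomes provable, which turns the
    implication into a disjunction. *)
Lemma regular_imp_body_underivable L :
  disjunction_property L ->
  ~ derives_in L []
      (Imp (Imp (Neg (Neg (Var 0))) (Var 0)) (Or (Var 0) (Neg (Var 0)))).
Proof.
  intros DP H; apply (weak_excluded_middle_underivable L DP).
  apply (derives_in_inst L _ (Neg (Var 0))) in H.
  apply (impE _ _ _ H), of_theorem; simpl.
  apply impR, impR, (impE _ (Neg (Neg (Var 0)))); [apply assumption; simpl; auto|].
  apply impR, (impE _ (Var 0)); apply assumption; simpl; auto.
Qed.

Theorem corollary4p17 (L : intermediate_logic)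
  (DP : disjunction_property L) :
  ~ defines L kreisel_star /\
  ~ defines L regular_or /\
  ~ defines L regular_imp.
Proof.
  split; [|split]; apply ex_iff_undefinable; auto.
  - apply (dense_of_excluded_middle (Neg (Var 0))), ax.
  - intros v Hv.
    rewrite forces_Or, !chain_forces_Neg by auto; tauto.
  - apply weak_excluded_middle_underivable, DP.
  - apply (dense_of_excluded_middle (Var 0)), orL; apply orR2, impR.
    + apply assumption; simpl; auto.
    + apply botE, (impE _ (Neg (Var 0))); apply assumption; simpl; auto.
  - intros v Hv.
    rewrite forces_Or, forces_false_Imp, !chain_forces_Neg by auto; tauto.
  - apply regular_or_body_underivable, DP.
  - apply (dense_of_excluded_middle (Var 0)), impR, assumption; simpl; auto.
  - intros v Hv.
    rewrite forces_false_Imp, forces_false_Imp, !forces_Or, !chain_forces_Neg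
      by auto; tauto.
  - apply regular_imp_body_underivable, DP.
Qed.
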